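(* Let $1\le p<\infty$, $p\neq 2$. If $\phi\in\mathbb{A}$ is parabolic and $\psi\in\mathbb{A}$, then the isometry $M_\psi U_\phi$ on $H^p$ is not Crownover.
   Context: $D$ is the open unit disc in $\mathbb{C}$, $\mathbb{T}$ the unit circle, $H^p$ the Hardy space of $D$ with its usual norm. $\mathbb{A}$ is the group (under composition) of holomorphic automorphisms of $D$, i.e. the maps $\phi(z)=\frac{\lambda(z-a)}{1-\overline{a}z}$ with $a\in D$, $|\lambda|=1$; $e(z)=z$. $\phi\in\mathbb{A}$, $\phi\neq e$, is parabolic if it has only one fixed point $w$ in $\overline{D}$; in this case $w\in\mathbb{T}$ and $\phi'(w)=1$. For $F\in H^\infty$, $M_F$ is multiplication by $F$ on $H^p$; $C_\phi f=f\circ\phi$. For $\phi(z)=\frac{\lambda(z-a)}{1-\overline{a}z}$ in $\mathbb{A}$ put $U_\phi=M_{(\overline{\lambda}\phi')^{1/p}}C_\phi$, where $\overline\lambda\phi'(z)=\frac{1-|a|^2}{(1-\overline a z)^2}$ and the $p$-th root is the principal branch $(re^{i\theta})^{1/p}=r^{1/p}e^{i\theta/p}$, $r>0$, $-\pi<\theta<\pi$. For $\phi,\psi\in\mathbb{A}$ the operator $M_\psi U_\phi$ is an isometry of $H^p$ whose range has codimension one. A codimension one isometry $S$ on $H^p$ is Crownover if $\bigcap_{n=1}^\infty S^nH^p=(0)$. *)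

(* Defs.v *)
From HB Require Import structures.
From mathcomp Require Import all_boot all_order all_algebra.
From mathcomp Require Import all_classical all_reals all_analysis.
From mathcomp Require Import complex.
Set Implicit Arguments.
Unset Strict Implicit.
Unset Printing Implicit Defensive.
Import Order.TTheory GRing.Theory Num.Theory.
Import numFieldNormedType.Exports.

Local Open Scope classical_set_scope.
Local Open Scope ring_scope.
Local Open Scope complex_scope.

Definition unit_disc (R : realType) : set R[i] := [set z | `|z| < 1].

Definition unit_circle (R : realType) : set R[i] := [set z | `|z| = 1].

Definition closed_unit_disc (R : realType) : set R[i] := [set z | `|z| <= 1].

(* e^{it} *)
Definition expi (R : realType) (t : R) : R[i] := cos t +i* sin t.

(* Used at K = R[i]: scalars, domain and codomain are the same field, so for
   complex K this is complex differentiability. *)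
Definition holomorphic_on (K : numFieldType) (A : set K) (f : K -> K) :=
  forall z, A z -> derivable f z 1.

Definition field_derive (K : numFieldType) (f : K -> K) : K -> K := derive1 f.

(* The real-valued modulus. *)
Definition cmod (R : realType) (z : R[i]) : R := complex.Re `|z|.

(* The p-th power mean of |f| over the circle of radius r, for the normalized
   arc length. *)
Definition integral_mean (R : realType) (p : R) (f : R[i] -> R[i]) (r : R) :
    \bar R :=
  (((2 * pi)^-1)%R%:E *
   \int[lebesgue_measure]_(t in `[0%R, (2 * pi)%R])
     (cmod (f (r%:C * expi t)%R) `^ p)%:E)%E.

Definition hardy_norm (R : realType) (p : R) (f : R[i] -> R[i]) : \bar R :=
  ereal_sup [set poweR (integral_mean p f r) p^-1 | r in `[0, 1[%classic].

(* A function on the disc is encoded as a function on R[i] vanishing off the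
   disc, so that equality of elements of H^p is Leibniz equality. *)
Definition hardy (R : realType) (p : R) : set (R[i] -> R[i]) :=
  [set f | [/\ forall z, ~ unit_disc z -> f z = 0,
               holomorphic_on (@unit_disc R) f &
               (hardy_norm p f < +oo)%E]].

Definition disc_aut (R : realType) (lam a : R[i]) (z : R[i]) : R[i] :=
  lam * (z - a) / (1 - a^* * z).

Definition Aut_disc (R : realType) : set (R[i] -> R[i]) :=
  [set phi | exists lam a,
     [/\ unit_circle lam, unit_disc a & phi = disc_aut lam a]].

(* The condition that the fixed point w lies on the circle is not redundant:
   an elliptic automorphism such as a rotation also has a single fixed point in
   the closed disc, but it lies inside. *)
Definition parabolic (R : realType) (phi : R[i] -> R[i]) :=
  [/\ Aut_disc phi, phi <> id &
      exists2 w, unit_circle w &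
        forall z, closed_unit_disc z -> (phi z = z <-> z = w)].

(* The argument in ]-pi, pi[; a dummy value where there is none or no unique
   one, i.e. on the closed negative half-line. *)
Definition principal_arg (R : realType) (z : R[i]) : R :=
  xget 0 [set t | (- pi < t < pi) /\ z = (cmod z)%:C * expi t].

Definition principal_root (R : realType) (p : R) (z : R[i]) : R[i] :=
  (cmod z `^ p^-1)%:C * expi (principal_arg z / p).

Definition mul_op (R : realType) (F f : R[i] -> R[i]) : R[i] -> R[i] :=
  fun z => F z * f z.

(* Cut off outside the disc to respect the encoding of [hardy]. *)
Definition comp_op (R : realType) (phi f : R[i] -> R[i]) : R[i] -> R[i] :=
  fun z => if `|z| < 1 then f (phi z) else 0.

(* U_phi for phi = disc_aut lam a. *)
Definition U_op (R : realType) (p : R) (lam a : R[i])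
    (f : R[i] -> R[i]) : R[i] -> R[i] :=
  let phi := disc_aut lam a in
  mul_op (fun z => principal_root p (lam^* * field_derive phi z)) (comp_op phi f).

(* The notion applies to codimension one isometries S of H^p, among them every
   M_psi U_phi. That requirement is not repeated here, where it could only
   weaken the negation of the property. *)
Definition crownover (R : realType) (p : R)
    (S : (R[i] -> R[i]) -> (R[i] -> R[i])) :=
  \bigcap_(n in [set n | (1 <= n)%N]) (iter n S @` hardy p) = [set cst 0].

(* Main.v *)
Require Import Defs.
From mathcomp Require Import all_boot all_order all_algebra.
From mathcomp Require Import all_classical all_reals all_analysis.
From mathcomp Require Import complex.
From mathcomp Require Import measurable_realfun ring lra.
Import Order.TTheory GRing.Theory Num.Theory.
Import numFieldNormedType.Exports.
Local Open Scope classical_set_scope.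
Local Open Scope ring_scope.

(** Let w be the fixed point of phi and S = M_psi U_phi. In the half-plane
    coordinate tau(z) = 1 / (1 - w^* z) the map phi becomes a translation
    tau |-> tau + ik with k a nonzero real number ([parabolic_translation]).
    With omega = 2 pi / |k| the function

      g(z) = 1 - exp (omega (tau(b) - tau(z))),

    where b is the zero of psi, is invariant under phi. It is bounded because
    Re tau > 0 on the disc, it is not zero, and it vanishes, by periodicity, at
    every point of the backward orbit Z = {phi^(-n)(b) | n >= 0}. The claim is
    that g lies in the range of every power of S.

    To solve S h = f one must take h = (f / (psi J)) o phi^(-1), where J is the
    p-th root occurring in U_phi. The root J is the exponential of a holomorphic
    function and 1 / J is bounded, so the only obstruction is the simple zero of
    psi at b. If f is bounded, holomorphic, and divisible by z - c for each c in
    Z, then f / psi is bounded and holomorphic, and h is again divisible by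
    z - c for each c in Z: the zero of f at b is used up, but phi^(-1) maps Z
    into Z without b, because a translation has no periodic points. This is
    [divisible_along_preimage]; applied n times from g it shows that g lies in
    S^n H^p, bounded holomorphic functions being in H^p
    ([bounded_holomorphic_hardy]).

    Only exponentials and Moebius maps have to be divided by z - c, and for
    those the quotient is explicit: everything reduces to the fact that
    (e^h - 1) / h is holomorphic at 0 ([cexp_slope_holomorphic0]). *)

(** * Complex derivatives through difference quotients *)

Definition holomorphic_at {K : numFieldType} (f : K -> K) (c : K) :=
  derivable f c 1.

(** Caratheodory's form of the derivative: once the increment of f is factored
    through z - c, continuity of the cofactor is enough. *)
Lemma is_derive_slope {K : numFieldType} (f q : K -> K) (c : K) :
  {for c, continuous q} ->
  (\forall z \near c, f z - f c = (z - c) * q z) -> is_derive c 1 f (q c).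
Proof.
move=> cq fq.
have shift : h + c @[h --> 0] --> c.
  rewrite -[X in _ --> X](add0r c).
  exact: (cvgD cvg_id (cvg_cst c)).
have lim : h^-1 *: (f (h *: 1 + c) - f c) @[h --> 0^'] --> q c.
  have qs : q (h + c) @[h --> 0^'] --> q c.
    by apply: cvg_within_filter; apply: cvg_comp shift cq.
  apply: cvg_trans qs; apply: near_eq_cvg.
  near=> h.
  have -> : f (h *: 1 + c) - f c = (h + c - c) * q (h + c).
    rewrite /GRing.scale /= mulr1.
    near: h.
    apply: (@cvg_within _ (nbhs (0:K))).
    exact: (shift _ fq).
  rewrite addrK /GRing.scale /= mulrA mulVf ?mul1r//.
  near: h; exact: nbhs_dnbhs_neq.
apply: DeriveDef; first by apply/cvg_ex; exists (q c).
exact/cvg_lim.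
Unshelve. all: by end_near. Qed.

Lemma continuous_at0_of_le {K : numFieldType} (q : K -> K) (M : K) :
  0 < M -> (forall h, `|h| <= 1 -> `|q h - q 0| <= M * `|h|) ->
  {for 0, continuous q}.
Proof.
move=> M0 qM; apply/(@cvgrPdist_le _ _ K (nbhs (0 : K))) => e e0.
have h1 : \forall h \near (0 : K), `|h| <= 1 by apply: nbhs0_le.
have h2 : \forall h \near (0 : K), `|h| <= e / M
  by apply: nbhs0_le; rewrite divr_gt0.
near=> h.
have hh : `|h| <= 1 by near: h; exact: h1.
rewrite distrC (le_trans (qM h hh))// mulrC -ler_pdivlMr//; near: h; exact: h2.
Unshelve. all: by end_near. Qed.

Lemma holomorphic_at_slope {K : numFieldType} (f q : K -> K) (c : K) :
  {for c, continuous q} ->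
  (\forall z \near c, f z - f c = (z - c) * q z) -> holomorphic_at f c.
Proof. by move=> cq fq; have [] := is_derive_slope _ _ _ cq fq. Qed.

Lemma field_derive_slope {K : numFieldType} (f q : K -> K) (c : K) :
  {for c, continuous q} ->
  (\forall z \near c, f z - f c = (z - c) * q z) -> field_derive f c = q c.
Proof.
move=> cq fq; have [_] := is_derive_slope _ _ _ cq fq.
by rewrite /field_derive derive1E.
Qed.

Lemma holomorphic_at_continuous {K : numFieldType} (f : K -> K) (c : K) :
  holomorphic_at f c -> {for c, continuous f}.
Proof. by move=> /derivable1_diffP df; exact: differentiable_continuous. Qed.

Lemma holomorphic_at_near {K : numFieldType} (f g : K -> K) (c : K) :
  (\forall z \near c, f z = g z) -> holomorphic_at f c -> holomorphic_at g c.
Proof. exact: near_eq_derivable. Qed.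

Lemma holomorphic_at_comp {K : numFieldType} (f g : K -> K) (c : K) :
  holomorphic_at f c -> holomorphic_at g (f c) ->
  holomorphic_at (fun z => g (f z)) c.
Proof.
move=> /derivable1_diffP df /derivable1_diffP dg.
by apply/derivable1_diffP; exact: differentiable_comp.
Qed.

Lemma holomorphic_at_cst {K : numFieldType} (a c : K) :
  holomorphic_at (fun=> a) c.
Proof. exact: derivable_cst. Qed.

Lemma holomorphic_at_id {K : numFieldType} (c : K) :
  holomorphic_at (fun z => z) c.
Proof. exact: derivable_id. Qed.

Lemma holomorphic_atB {K : numFieldType} (f g : K -> K) (c : K) :
  holomorphic_at f c -> holomorphic_at g c ->
  holomorphic_at (fun z => f z - g z) c.
Proof. exact: derivableB. Qed.

Lemma holomorphic_atM {K : numFieldType} (f g : K -> K) (c : K) :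
  holomorphic_at f c -> holomorphic_at g c ->
  holomorphic_at (fun z => f z * g z) c.
Proof. exact: derivableM. Qed.

Lemma holomorphic_atV {K : numFieldType} (f : K -> K) (c : K) :
  f c != 0 -> holomorphic_at f c -> holomorphic_at (fun z => (f z)^-1) c.
Proof. exact: derivableV. Qed.

(** * Taylor bounds for the real exponential, sine and cosine *)

(** The mean value theorem gains one power of |x|; iterating it from a crude
    bound yields all the Taylor estimates below. *)
Lemma norm_le_of_derive {R : realType} (f df : R -> R) (M r : R) (n : nat) :
  (forall x : R, is_derive x (1 : R) f (df x)) -> f 0 = 0 -> 0 <= M ->
  (forall x, `|x| <= r -> `|df x| <= M * `|x| ^+ n) ->
  forall x, `|x| <= r -> `|f x| <= M * `|x| ^+ n.+1.
Proof.
move=> fdf f0 M0 dfM x xr.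
have fc a b : {within `[a, b], continuous f}.
  apply: derivable_within_continuous => y _.
  by have [] := fdf y.
have fdf' (a b y : R) : y \in `]a, b[ -> is_derive y (1 : R) f (df y) by [].
have key c : `|c| <= `|x| -> f x = df c * x -> `|f x| <= M * `|x| ^+ n.+1.
  move=> cx ->; rewrite normrM exprSr mulrA ler_wpM2r//.
  rewrite (le_trans (dfM c (le_trans cx xr)))//.
  by rewrite ler_wpM2l// lerXn2r// nnegrE.
have [x0|x0] := leP 0 x.
  have [c] := MVT_segment x0 (fdf' 0 x) (fc 0 x).
  rewrite in_itv/= f0 !subr0 => /andP[c0 cx]; apply: key.
  by rewrite !ger0_norm.
have [c] := MVT_segment (ltW x0) (fdf' x 0) (fc x 0).
rewrite in_itv/= f0 !sub0r mulrN => /andP[c0 cx] /oppr_inj; apply: key.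
by rewrite !ler0_norm ?lerN2// ltW.
Qed.

Lemma sin_le {R : realType} (y : R) : `|sin y| <= `|y|.
Proof.
rewrite -[leRHS]mul1r -[in leRHS](expr1 `|y|).
apply: (@norm_le_of_derive _ sin cos 1 `|y|) => //; first exact: sin0.
by move=> x _; rewrite expr0 mulr1 cos_max.
Qed.

Lemma cos_sub1_le {R : realType} (y : R) : `|cos y - 1| <= `|y| ^+ 2.
Proof.
rewrite -[leRHS]mul1r.
apply: (@norm_le_of_derive _ (fun y => cos y - 1) (fun y => - sin y)
  1 `|y|) => //.
- by move=> x; apply: is_derive_eq; rewrite subr0.
- by rewrite cos0 subrr.
- by move=> x _; rewrite expr1 mul1r normrN sin_le.
Qed.

Lemma sin_sub_le {R : realType} (y : R) : `|sin y - y| <= `|y| ^+ 3.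
Proof.
rewrite -[leRHS]mul1r.
apply: (@norm_le_of_derive _ (fun y => sin y - y) (fun y => cos y - 1)
  1 `|y|) => //.
- by rewrite sin0 subrr.
- by move=> x _; rewrite mul1r cos_sub1_le.
Qed.

Lemma cos_sub_le {R : realType} (y : R) :
  `|cos y - 1 + y ^+ 2 / 2| <= `|y| ^+ 4.
Proof.
rewrite -[leRHS]mul1r.
apply: (@norm_le_of_derive _ (fun y => cos y - 1 + y ^+ 2 / 2)
  (fun y => y - sin y) 1 `|y|) => //.
- move=> x; apply: is_derive_eq.
  by rewrite /GRing.scale/=; field.
- by rewrite cos0 subrr expr0n/= mul0r addr0.
- by move=> x _; rewrite mul1r distrC sin_sub_le.
Qed.

(** The constant 4 bounds e = (e^(-1/2))^(-2), since e^(-1/2) >= 1/2. *)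
Lemma expR_taylor0 {R : realType} (x : R) : `|x| <= 1 -> `|expR x| <= 4.
Proof.
move=> x1; rewrite ger0_norm ?expR_ge0// (@le_trans _ _ (expR 1))//.
  by rewrite ler_expR (le_trans (ler_norm x)).
have h : 1 / 2 <= expR (- (1 / 2) : R) by have := expR_ge1Dx (- (1/2) : R); lra.
have -> : expR (1 : R) = (expR (- (1 / 2)))^-1 * (expR (- (1 / 2)))^-1.
  by rewrite -!expRN -expRD; congr expR; field.
rewrite -invfM -[4]invrK lef_pV2 ?posrE ?mulr_gt0 ?expR_gt0//.
set e := expR _ in h *; nra.
Qed.

Lemma expR_taylor1 {R : realType} (x : R) :
  `|x| <= 1 -> `|expR x - 1| <= 4 * `|x|.
Proof.
rewrite -[in X in _ -> X](expr1 `|x|); move: x.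
apply: (@norm_le_of_derive _ (fun y => expR y - 1) expR 4 1) => //.
- by move=> x; apply: is_derive_eq; rewrite subr0.
- by rewrite expR0 subrr.
- by move=> x x1; rewrite mulr1 expR_taylor0.
Qed.

Lemma expR_taylor2 {R : realType} (x : R) :
  `|x| <= 1 -> `|expR x - 1 - x| <= 4 * `|x| ^+ 2.
Proof.
move: x; apply: (@norm_le_of_derive _ (fun y => expR y - 1 - y)
  (fun y => expR y - 1) 4 1) => //.
- by move=> x; apply: is_derive_eq; rewrite subr0.
- by rewrite expR0 subrr subr0.
- by move=> x x1; rewrite expr1 expR_taylor1.
Qed.

Lemma expR_taylor3 {R : realType} (x : R) :
  `|x| <= 1 -> `|expR x - 1 - x - x ^+ 2 / 2| <= 4 * `|x| ^+ 3.
Proof.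
move: x; apply: (@norm_le_of_derive _ (fun y => expR y - 1 - y - y ^+ 2 / 2)
  (fun y => expR y - 1 - y) 4 1) => //.
- by move=> x; apply: is_derive_eq; rewrite /GRing.scale/=; field.
- by rewrite expR0 subrr expr0n/= mul0r !subr0.
- by move=> x x1; rewrite expR_taylor2.
Qed.

(** * The complex exponential *)

(** The norm of a complex number is itself complex, with zero imaginary part. *)
Lemma normc_cmod {R : realType} (z : R[i]) : `|z| = (cmod z)%:C%C.
Proof. by rewrite /cmod normc_def. Qed.

Lemma cmod_ge0 {R : realType} (z : R[i]) : 0 <= cmod z.
Proof. by rewrite /cmod normc_def/= sqrtr_ge0. Qed.

Lemma cmod_le_ReIm {R : realType} (z : R[i]) :
  cmod z <= `|complex.Re z| + `|complex.Im z|.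
Proof.
rewrite /cmod normc_def/= -[leRHS]ger0_norm ?addr_ge0// -sqrtr_sqr.
rewrite ler_sqrt ?sqr_ge0// sqrrD !real_normK ?num_real//.
by rewrite lerD2r lerDl mulrn_wge0 ?mulr_ge0.
Qed.

Lemma Re_le_cmod {R : realType} (z : R[i]) : `|complex.Re z| <= cmod z.
Proof.
rewrite /cmod normc_def/= -sqrtr_sqr ler_sqrt ?addr_ge0 ?sqr_ge0//.
by rewrite lerDl sqr_ge0.
Qed.

Lemma Im_le_cmod {R : realType} (z : R[i]) : `|complex.Im z| <= cmod z.
Proof.
rewrite /cmod normc_def/= -sqrtr_sqr ler_sqrt ?addr_ge0 ?sqr_ge0//.
by rewrite lerDr sqr_ge0.
Qed.

Definition cexp {R : realType} (z : R[i]) : R[i] :=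
  (expR (complex.Re z))%:C%C * expi (complex.Im z).

Lemma cexpD {R : realType} (z w : R[i]) : cexp (z + w) = cexp z * cexp w.
Proof.
case: z w => [a b] [c d]; rewrite /cexp /expi /= expRD cosD sinD.
by apply/eqP; rewrite eq_complex /=; apply/andP; split; apply/eqP; ring.
Qed.

Lemma cexp0 {R : realType} : cexp (0 : R[i]) = 1.
Proof.
rewrite /cexp /expi /= expR0 cos0 sin0.
by apply/eqP; rewrite eq_complex /=; apply/andP; split; apply/eqP; ring.
Qed.

Lemma cmod_cexp {R : realType} (z : R[i]) : cmod (cexp z) = expR (complex.Re z).
Proof.
rewrite /cmod normc_def /cexp /expi /= !mul0r subr0 addr0.
rewrite !exprMn -mulrDr cos2Dsin2 mulr1 sqrtr_sqr ger0_norm ?expR_ge0//.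
Qed.

(** The quadratic term is what makes (e^h - 1) / h differentiable at 0; first
    order would only give continuity. *)
Lemma cexp_taylor3 {R : realType} (h : R[i]) : `|h| <= 1 ->
  `|cexp h - 1 - h - h ^+ 2 / 2| <= 18 * `|h| ^+ 3.
Proof.
rewrite !normc_cmod -[1]/((1 : R)%:C%C) lecR => h1.
suff : cmod (cexp h - 1 - h - h ^+ 2 / 2) <= 18 * cmod h ^+ 3.
  rewrite -lecR; congr (_ <= _); rewrite rmorphM rmorphXn/=; congr (_ * _).
  by rewrite rmorph_nat.
have xm := Re_le_cmod h; have ym := Im_le_cmod h.
rewrite (le_trans (cmod_le_ReIm _))//.
move: h1 xm ym; set m := cmod h; move: m => m m1; case: h => x y /= xm ym.
have e0 := expR_taylor0 _ (le_trans xm m1).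
have e1 := expR_taylor1 _ (le_trans xm m1).
have e2 := expR_taylor2 _ (le_trans xm m1).
have e3 := expR_taylor3 _ (le_trans xm m1).
have c4 := cos_sub_le y.
have s3 := sin_sub_le y.
have m0 : 0 <= m := le_trans (normr_ge0 _) xm.
have prod a b k l i j : `|a| <= k * m ^+ i -> `|b| <= l * m ^+ j ->
    0 <= k -> 0 <= l -> `|a * b| <= k * l * m ^+ (i + j).
  move=> ak bl k0 l0; rewrite normrM exprD mulrACA.
  by rewrite ler_pM.
have up k i a : 0 <= k -> 0 <= a -> a <= m -> k * a ^+ i <= k * m ^+ i.
  by move=> k0 a0 am; rewrite ler_wpM2l// lerXn2r// nnegrE.
(* Each remainder isolates the real Taylor remainders. The three terms of the
   real part contribute 4 + 2 + 4 to the constant 18, the two of the imaginary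
   part 4 + 4. *)
have re : expR x * cos y - 1 - x - (x ^+ 2 - y ^+ 2) / 2 =
   (expR x - 1 - x - x ^+ 2 / 2) + (expR x - 1) * (- (y ^+ 2 / 2))
   + expR x * (cos y - 1 + y ^+ 2 / 2) by field.
have im : expR x * sin y - y - x * y =
   (expR x - 1 - x) * y + expR x * (sin y - y) by ring.
have m43 : m ^+ 4 <= m ^+ 3 by rewrite exprS ler_piMl// exprn_ge0.
have B1 := le_trans e3 (up _ 3%N _ (ler0n _ 4) (normr_ge0 x) xm).
have B2 : `|(expR x - 1) * (- (y ^+ 2 / 2))| <= 4 * 2^-1 * m ^+ (1 + 2).
  apply: prod => //.
    exact: le_trans e1 (up _ 1%N _ (ler0n _ 4) (normr_ge0 x) xm).
  rewrite normrN normrM normrX mulrC [`|2^-1|]ger0_norm//.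
  by apply: up.
have B3 : `|expR x * (cos y - 1 + y ^+ 2 / 2)| <= 4 * 1 * m ^+ (0 + 4).
  apply: prod; rewrite ?expr0 ?mulr1// mul1r.
  by rewrite (le_trans c4)// lerXn2r// nnegrE.
have B4 : `|(expR x - 1 - x) * y| <= 4 * 1 * m ^+ (2 + 1).
  apply: prod; rewrite ?mul1r//.
  exact: le_trans e2 (up _ 2%N _ (ler0n _ 4) (normr_ge0 x) xm).
have B5 : `|expR x * (sin y - y)| <= 4 * 1 * m ^+ (0 + 3).
  apply: prod; rewrite ?expr0 ?mulr1// mul1r.
  by rewrite (le_trans s3)// lerXn2r// nnegrE.
rewrite [X in `|X| + _ <= _](_ : _ =
  expR x * cos y - 1 - x - (x ^+ 2 - y ^+ 2) / 2); last by field.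
rewrite [X in _ + `|X| <= _](_ : _ = expR x * sin y - y - x * y); last by field.
rewrite re im.
rewrite (le_trans (lerD (ler_normD _ _) (ler_normD _ _)))//.
have := ler_normD (expR x - 1 - x - x ^+ 2 / 2)
  ((expR x - 1) * (- (y ^+ 2 / 2))).
rewrite /= in B1 B2 B3 B4 B5.
lra.
Qed.

(** The value 1 at 0 removes the singularity of the quotient. *)
Definition cexp_slope {R : realType} (h : R[i]) : R[i] :=
  if h == 0 then 1 else (cexp h - 1) / h.

Lemma cexp_slopeE {R : realType} (h : R[i]) : cexp h - 1 = h * cexp_slope h.
Proof.
rewrite /cexp_slope; case: eqVneq => [->|h0].
  by rewrite cexp0 subrr mul0r.
by rewrite mulrCA divff ?mulr1.
Qed.

(** This makes the zeros of 1 - exp divisible: at a point c where exp (u(c)) = 1,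
    the quotient of exp (u(z)) - 1 by u(z) - u(c) is the slope at u(z) - u(c). *)
Lemma cexp_slope_holomorphic0 {R : realType} :
  holomorphic_at (@cexp_slope R) 0.
Proof.
pose q (h : R[i]) := if h == 0 then 2^-1 else (cexp_slope h - 1) / h.
apply: (holomorphic_at_slope _ q); last first.
  near=> h; rewrite /q subr0 {2}/cexp_slope eqxx.
  case: (eqVneq h 0) => [->|h0]; first by rewrite /cexp_slope eqxx subrr mul0r.
  by rewrite mulrCA divff ?mulr1.
have qT (h : R[i]) : `|h| <= 1 -> `|q h - 2^-1| <= 18 * `|h|.
  move=> h1; rewrite /q; case: eqVneq => [->|h0].
    by rewrite subrr normr0 mulr0.
  rewrite -(ler_pM2r (_ : 0 < `|h| ^+ 2)) ?exprn_gt0 ?normr_gt0//.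
  rewrite -mulrA -exprS -[X in _ * X]normrX -normrM.
  rewrite (_ : _ * h ^+ 2 = cexp h - 1 - h - h ^+ 2 / 2) ?cexp_taylor3//.
  by rewrite /cexp_slope (negbTE h0); field.
apply: (continuous_at0_of_le _ 18) => // h h1.
by rewrite {2}/q eqxx; exact: qT.
Unshelve. all: by end_near. Qed.

Lemma cexp_sub {R : realType} (z c : R[i]) :
  cexp z - cexp c = (z - c) * (cexp c * cexp_slope (z - c)).
Proof.
rewrite mulrCA -cexp_slopeE mulrBr mulr1 -cexpD; congr (cexp _ - _); ring.
Qed.

Lemma cexp_quotient_continuous {R : realType} (c : R[i]) :
  {for c, continuous (fun z : (R[i] : numFieldType) =>
    cexp c * cexp_slope (z - c) : (R[i] : numFieldType))}.
Proof.
apply: holomorphic_at_continuous; apply: holomorphic_atM.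
  exact: holomorphic_at_cst.
apply: (holomorphic_at_comp (fun z => z - c)).
  apply: holomorphic_atB; first exact: holomorphic_at_id.
  exact: holomorphic_at_cst.
by rewrite subrr; exact: cexp_slope_holomorphic0.
Qed.

Lemma cexp_holomorphic {R : realType} (c : R[i]) : holomorphic_at (@cexp R) c.
Proof.
apply: (holomorphic_at_slope _ (fun z => cexp c * cexp_slope (z - c))).
  exact: cexp_quotient_continuous.
by near=> z; exact: cexp_sub.
Unshelve. all: by end_near. Qed.

(** * The logarithm on the right half-plane *)

Lemma ReB {R : realType} (z w : R[i]) :
  complex.Re (z - w) = complex.Re z - complex.Re w.
Proof. by case: z w => [? ?] [? ?]. Qed.

Lemma ImB {R : realType} (z w : R[i]) :
  complex.Im (z - w) = complex.Im z - complex.Im w.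
Proof. by case: z w => [? ?] [? ?]. Qed.

Lemma near_dist_lt {K : numFieldType} (c e : K) :
  0 < e -> \forall z \near c, `|c - z| < e.
Proof. exact: (@cvgr_dist_lt _ _ _ (nbhs c) _ id c cvg_id). Qed.

Lemma continuous_of_cmod {R : realType} (f : (R[i] : numFieldType) -> R) :
  (forall z w : R[i], `|f z - f w| <= cmod (z - w)) -> continuous f.
Proof.
move=> fL c; apply/(@cvgrPdist_lt _ _ _ (nbhs c)) => e e0.
have h : \forall z \near c, `|c - z| < e%:C%C.
  by apply: near_dist_lt; rewrite ltcR.
near=> z.
have : `|c - z| < e%:C%C by near: z; exact: h.
by rewrite normc_cmod ltcR; exact: le_lt_trans.
Unshelve. all: by end_near. Qed.

Lemma Re_continuous {R : realType} :
  continuous (@complex.Re R : (R[i] : numFieldType) -> R).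
Proof. by apply: continuous_of_cmod => z w; rewrite -ReB Re_le_cmod. Qed.

Lemma Im_continuous {R : realType} :
  continuous (@complex.Im R : (R[i] : numFieldType) -> R).
Proof. by apply: continuous_of_cmod => z w; rewrite -ImB Im_le_cmod. Qed.

Lemma cmod_continuous {R : realType} :
  continuous (@cmod R : (R[i] : numFieldType) -> R).
Proof.
apply: continuous_of_cmod => z w; rewrite -lecR -normc_cmod.
rewrite (le_trans _ (ler_dist_dist z w))// !normc_cmod -rmorphB/= lecR.
by rewrite [leRHS]/cmod normc_def/= expr0n/= addr0 sqrtr_sqr.
Qed.

(** Real limits give complex limits because |z| <= |Re z| + |Im z|. *)
Lemma cvg_Complex {R : realType} {T : Type} (F : set_system T) {FF : Filter F}
    (u v : T -> R) (a b : R) :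
  u @ F --> a -> v @ F --> b ->
  (fun t => Complex (u t) (v t) : (R[i] : numFieldType)) @ F -->
    (Complex a b : (R[i] : numFieldType)).
Proof.
move=> ua vb; apply/(@cvgrPdist_lt _ _ _ F) => -[e e'].
rewrite ltcE/= => /andP[/eqP -> e0].
have hu : \forall t \near F, `|a - u t| < e / 2.
  by apply: (cvgr_dist_lt _ _ ua); rewrite divr_gt0.
have hv : \forall t \near F, `|b - v t| < e / 2.
  by apply: (cvgr_dist_lt _ _ vb); rewrite divr_gt0.
near=> t.
rewrite normc_cmod ltcR (le_lt_trans (cmod_le_ReIm _))//= (splitr e) ltrD//.
- by near: t; exact: hu.
- by near: t; exact: hv.
Unshelve. all: by end_near. Qed.

(** On the right half-plane the argument is the arctangent of the slope. *)
Definition clog {R : realType} (z : R[i]) : R[i] :=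
  Complex (ln (cmod z)) (atan (complex.Im z / complex.Re z)).

Lemma cmod_gt0 {R : realType} (z : R[i]) : 0 < complex.Re z -> 0 < cmod z.
Proof.
by move=> z0; rewrite (lt_le_trans _ (Re_le_cmod z))// normr_gt0 gt_eqF.
Qed.

Lemma clogK {R : realType} (z : R[i]) : 0 < complex.Re z -> cexp (clog z) = z.
Proof.
move=> z0; have m0 := cmod_gt0 _ z0.
rewrite /cexp /expi /= lnK ?posrE//.
set t := complex.Im z / complex.Re z.
have st : sin (atan t) = t * cos (atan t).
  rewrite -{2}[t]atanK /tan divfK// gt_eqF//.
  by rewrite cos_gt0_pihalf// atan_gtNpi2 atan_ltpi2.
have mE : cmod z = complex.Re z * Num.sqrt (1 + t ^+ 2).
  rewrite /cmod normc_def/= -[in RHS](ger0_norm (ltW z0)) -sqrtr_sqr.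
  rewrite -sqrtrM ?sqr_ge0//.
  by congr Num.sqrt; rewrite /t; field; rewrite gt_eqF.
have s0 : Num.sqrt (1 + t ^+ 2) != 0.
  by rewrite sqrtr_eq0 -ltNge ltr_pwDl// sqr_ge0.
have xn0 : complex.Re z != 0 by rewrite gt_eqF.
rewrite st cos_atan mE.
rewrite {}/t in s0 st mE *; case: z xn0 {z0 m0 mE st} s0 => x y /= xn0 s0.
apply/eqP; rewrite eq_complex /=; apply/andP; split; apply/eqP; field.
  by rewrite s0.
by rewrite s0 xn0.
Qed.

Lemma clog_continuous {R : realType} (c : R[i]) :
  0 < complex.Re c -> 
  {for c, continuous (clog : (R[i] : numFieldType) -> (R[i] : numFieldType))}.
Proof.
move=> c0; pose cK : (R[i] : numFieldType) := c.
have hln : ln (cmod t) @[t --> cK] --> ln (cmod c).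
  apply: (@continuous_comp _ _ _ (@cmod R : (R[i] : numFieldType) -> R)
    (@ln R)).
    exact: cmod_continuous.
  exact: continuous_ln (cmod_gt0 _ c0).
have hdiv : complex.Im t / complex.Re t @[t --> cK] -->
    complex.Im c / complex.Re c.
  apply: (cvgM (Im_continuous cK)); apply: cvgV (Re_continuous cK).
  by rewrite gt_eqF.
have hatan : atan (complex.Im t / complex.Re t) @[t --> cK] -->
    atan (complex.Im c / complex.Re c).
  exact: (cvg_comp _ _ hdiv (@continuous_atan R _)).
exact: cvg_Complex hln hatan.
Qed.

(** A continuous right inverse L of G is differentiable at c when G has nonzero
    derivative at L c: the difference quotient of L is the inverse of the one
    of G, evaluated along L. *)
Lemma holomorphic_at_section {K : numFieldType} (G q L : K -> K) (c : K) :
  {for c, continuous L} -> {for L c, continuous q} -> q (L c) != 0 ->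
  (forall w, G w - G (L c) = (w - L c) * q w) ->
  (\forall z \near c, G (L z) = z) -> holomorphic_at L c.
Proof.
move=> Lc qc q0 Gq GL.
have GLc : G (L c) = c := nbhs_singleton GL.
apply: (holomorphic_at_slope _ (fun z => (q (L z))^-1)).
  by apply: (@cvgV _ _ (nbhs c)) => //; exact: (@continuous_comp _ _ _ L q).
near=> z.
have E : z - c = (L z - L c) * q (L z).
  by rewrite -Gq GLc; congr (_ - _); apply/esym; near: z.
(* Vanishing of the slope at L z would force z = c, where it does not vanish. *)
have [qz0|qz0] := eqVneq (q (L z)) 0.
  move: E; rewrite qz0 mulr0 => /eqP; rewrite subr_eq0 => /eqP zc.
  by move: qz0 q0; rewrite zc => ->; rewrite eqxx.
by rewrite E mulfK.
Unshelve. all: by end_near. Qed.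

Lemma clog_holomorphic {R : realType} (c : R[i]) :
  0 < complex.Re c -> holomorphic_at clog c.
Proof.
move=> c0.
apply: (holomorphic_at_section (@cexp R)
  (fun w => cexp (clog c) * cexp_slope (w - clog c))).
- exact: clog_continuous.
- exact: cexp_quotient_continuous.
- rewrite subrr /cexp_slope eqxx mulr1 clogK//.
  by apply/eqP => cE; rewrite cE ltxx in c0.
- by move=> w; exact: cexp_sub.
have Re0 : \forall z \near (c : (R[i] : numFieldType)), 0 < complex.Re z.
  exact: (cvgr_gt _ (Re_continuous (c : (R[i] : numFieldType)))).
by near=> z; apply: clogK; near: z; exact: Re0.
Unshelve. all: by end_near. Qed.

(** * Principal roots of exponentials *)

(** Equal directions give cos (s - t) = 1, so sin ((s - t) / 2) = 0 with
    |(s - t) / 2| < pi. *)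
Lemma expi_inj {R : realType} (s t : R) :
  - pi < s < pi -> - pi < t < pi -> expi s = expi t -> s = t.
Proof.
move=> /andP[s1 s2] /andP[t1 t2] [cst sst].
pose d := (s - t) / 2.
have sd0 : sin d ^+ 2 = 0.
  have : cos (d *+ 2) = 1.
    have -> : d *+ 2 = s - t by rewrite /d -mulr_natr; field.
    by rewrite cosB cst sst -!expr2 cos2Dsin2.
  by rewrite cos_mulr2n cos2sin2 mulr2n; lra.
move: sd0 => /eqP; rewrite sqrf_eq0 => /eqP sd0.
have [d0|d0|d0] := ltgtP d 0; last by rewrite /d in d0; lra.
  have := @sin_gt0_pi R (- d); rewrite sinN sd0 oppr0 ltxx => H.
  by have : false by apply: H; rewrite /d in d0 *; lra.
have := @sin_gt0_pi R d; rewrite sd0 ltxx => H.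
by have : false by apply: H; rewrite /d in d0 *; lra.
Qed.

Lemma principal_arg_cexp {R : realType} (L : R[i]) :
  - pi < complex.Im L < pi -> principal_arg (cexp L) = complex.Im L.
Proof.
move=> hL; apply: xget_unique => [|t [ht]].
  by split => //; rewrite cmod_cexp.
rewrite cmod_cexp /cexp => /mulfI H; apply: expi_inj => //; apply/esym/H.
by rewrite -[0]/((0:R)%:C%C) (inj_eq (@complexI R)) gt_eqF// expR_gt0.
Qed.

Lemma principal_root_cexp {R : realType} (p : R) (L : R[i]) :
  - pi < complex.Im L < pi -> principal_root p (cexp L) = cexp (p^-1%:C%C * L).
Proof.
move=> hL; rewrite /principal_root principal_arg_cexp// cmod_cexp.
case: L {hL} => x y /=; rewrite /cexp/= !mul0r subr0 addr0 -expRM.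
by rewrite [x / p]mulrC [y / p]mulrC.
Qed.

(** * Bounded holomorphic functions are in the Hardy space *)

(** All circle means are at most M^p; the integrand is measurable because f is
    continuous on the disc. *)
Lemma bounded_holomorphic_hardy {R : realType} (p : R) (f : R[i] -> R[i])
    (M : R[i]) :
  0 < p -> (forall z, ~ unit_disc z -> f z = 0) ->
  holomorphic_on (@unit_disc R) f ->
  (forall z, unit_disc z -> `|f z| <= M) -> hardy p f.
Proof.
move=> p0 f0 holf fM; split => //.
have fM' z : unit_disc z -> cmod (f z) <= complex.Re M.
  by move=> /fM; rewrite normc_cmod lecE/= => /andP[].
have disc_r r t : 0 <= r < 1 -> unit_disc (r%:C%C * @expi R t).
  move=> /andP[r0 r1]; rewrite /unit_disc/= normc_cmod /cmod normc_def/=.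
  rewrite !mul0r subr0 addr0 !exprMn -mulrDr cos2Dsin2 mulr1 sqrtr_sqr.
  by rewrite ger0_norm// -[1]/((1 : R)%:C%C) ltcR.
set N := complex.Re M.
have N0 : 0 <= N.
  rewrite (le_trans (cmod_ge0 (f 0)))// fM'// /unit_disc/= normr0 ltr01//.
apply: (@le_lt_trans _ _ (N `^ p `^ p^-1)%:E); last exact: ltry.
apply: ge_ereal_sup => _ [r + <-]; rewrite /= in_itv/= => r01.
have cont : continuous (fun t => cmod (f (r%:C%C * expi t))).
  move=> t.
  apply: (@continuous_comp R (R[i] : numFieldType) R
    (fun t => f (r%:C%C * expi t)) (@cmod R)); last exact: cmod_continuous.
  apply: (@continuous_comp R (R[i] : numFieldType) (R[i] : numFieldType)
    (fun t => r%:C%C * expi t) f).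
    apply: cvgM; first exact: cvg_cst.
    by apply: cvg_Complex; [exact: continuous_cos|exact: continuous_sin].
  by apply: holomorphic_at_continuous; apply: holf; exact: disc_r.
have mf : measurable_fun setT (fun t => cmod (f (r%:C%C * expi t)) `^ p).
  apply: (measurableT_comp (f := fun x : R => x `^ p)).
    exact: measurable_powR.
  exact: continuous_measurable_fun.
have le_mean : (integral_mean p f r <= (N `^ p)%:E)%E.
  rewrite /integral_mean.
  have pi0 : 0 < 2 * pi :> R by rewrite mulr_gt0 ?pi_gt0.
  apply: (@le_trans _ _ (((2 * pi)^-1)%R%:E *
    \int[lebesgue_measure]_(t in `[0%R, (2 * pi)%R]) (cst (N `^ p)%:E t))%E).
    rewrite lee_pmul2l// ?lte_fin ?invr_gt0//.
    apply: ge0_le_integral => //=.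
    - by move=> t _; rewrite lee_fin powR_ge0.
    - exact/measurable_EFinP/measurable_funTS.
    - move=> t _; rewrite lee_fin ge0_ler_powR ?nnegrE ?cmod_ge0 ?(ltW p0)//.
      by rewrite fM'//; exact: disc_r.
  rewrite integral_cst//= lebesgue_measure_itv/= lte_fin pi0 oppr0 addr0.
  by rewrite -!EFinM lee_fin mulrCA mulVf ?mulr1// gt_eqF.
rewrite -poweR_EFin; apply: gt0_ler_poweR => //; first by rewrite invr_ge0 ltW.
  rewrite in_itv/= leey andbT /integral_mean mule_ge0//.
    by rewrite lee_fin invr_ge0 mulr_ge0 ?pi_ge0.
  by apply: integral_ge0 => t _; rewrite lee_fin powR_ge0.
by rewrite in_itv/= leey andbT lee_fin powR_ge0.
Qed.

(** * Dividing out a zero *)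

(** The holomorphic quotient is part of the datum. For a holomorphic f it exists
    as soon as f c = 0, by power series expansion; here it is always explicit
    and is carried through products, compositions and divisions instead. *)
Definition removable_zero {K : numFieldType} (f : K -> K) (c : K) :=
  exists2 q, holomorphic_at q c & \forall z \near c, f z = (z - c) * q z.

Lemma removable_zero_near {K : numFieldType} (f g : K -> K) (c : K) :
  (\forall z \near c, f z = g z) -> removable_zero f c -> removable_zero g c.
Proof.
move=> fg [q hq fq]; exists q => //.
near=> z; rewrite -(near fg z)//; near: z; exact: fq.
Unshelve. all: by end_near. Qed.

Lemma removable_zeroM {K : numFieldType} (f g : K -> K) (c : K) :
  removable_zero f c -> holomorphic_at g c ->
  removable_zero (fun z => f z * g z) c.
Proof.
move=> [q hq fq] hg; exists (fun z => q z * g z); first exact: holomorphic_atM.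
by near=> z; rewrite mulrA; congr (_ * _); near: z.
Unshelve. all: by end_near. Qed.

Lemma removable_zero_comp {K : numFieldType} (f m : K -> K) (c : K) :
  removable_zero f (m c) -> holomorphic_at m c ->
  removable_zero (fun z => m z - m c) c -> removable_zero (fun z => f (m z)) c.
Proof.
move=> [q hq fq] hm [r hr mr]; exists (fun z => r z * q (m z)).
  by apply: holomorphic_atM => //; exact: holomorphic_at_comp.
have fqm : \forall z \near c, f (m z) = (m z - m c) * q (m z).
  exact: (holomorphic_at_continuous _ _ hm _ fq).
near=> z; rewrite mulrA (near fqm z)//; congr (_ * _); near: z; exact: mr.
Unshelve. all: by end_near. Qed.

Lemma removable_zero0 {K : numFieldType} (f : K -> K) (c : K) :
  removable_zero f c -> f c = 0.
Proof. by move=> [q _ /nbhs_singleton ->]; rewrite subrr mul0r. Qed.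

Lemma near_neq {K : numFieldType} (b c : K) : c != b ->
  \forall z \near c, z != b.
Proof.
move=> cb; have e0 : 0 < `|c - b| by rewrite normr_gt0 subr_eq0.
have h := near_dist_lt c _ e0.
near=> z; apply/eqP => zb.
have : `|c - z| < `|c - b| by near: z; exact: h.
by rewrite zb ltxx.
Unshelve. all: by end_near. Qed.

(** The quotient is bounded near b by continuity, and away from b because
    |z - b| is bounded below there. *)
Lemma divide_zero {K : numFieldType} (A : set K) (f : K -> K) (b M : K) :
  holomorphic_on A f -> (forall z, A z -> `|f z| <= M) -> removable_zero f b ->
  exists Q N, [/\ holomorphic_on A Q, forall z, A z -> `|Q z| <= N,
    forall z, f z = (z - b) * Q z &
    forall c, c != b -> removable_zero f c -> removable_zero Q c].
Proof.
move=> holf fM fb; have [q hq fq] := fb.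
pose Q z := if z == b then q b else f z / (z - b).
have fQ z : f z = (z - b) * Q z.
  rewrite /Q; case: eqVneq => [->|zb].
    by rewrite subrr mul0r; exact: removable_zero0.
  by rewrite mulrCA divff ?mulr1// subr_eq0.
have Qq : \forall z \near b, q z = Q z.
  near=> z; rewrite /Q; case: eqVneq => [->//|zb].
  by rewrite (near fq z)// [(z - b) * _]mulrC mulfK ?subr_eq0//; near: z.
have Qnear c : c != b -> \forall z \near c, f z * (z - b)^-1 = Q z.
  move=> cb; have h := near_neq _ _ cb; near=> z.
  by rewrite /Q ifN//; near: z.
have hinv c : c != b -> holomorphic_at (fun z => (z - b)^-1) c.
  move=> cb; apply: holomorphic_atV; first by rewrite subr_eq0.
  apply: holomorphic_atB; first exact: holomorphic_at_id.
  exact: holomorphic_at_cst.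
have [e e0 Qe] : exists2 e, 0 < e &
    forall z, `|b - z| < e -> `|Q z| <= `|q b| + 1.
  have Q1 : \forall z \near b, `|Q z| <= `|q b| + 1.
    have := @cvgr_dist_le _ _ _ (nbhs b) _ q (q b)
      (holomorphic_at_continuous _ _ hq) 1 ltr01.
    move=> q1; near=> z.
    rewrite -(near Qq z)// -lerBlDl (le_trans (lerB_dist _ _))// distrC.
    by near: z; exact: q1.
  have /nbhs_ballP[e /= e0 be] := Q1.
  by exists e => // z bz; apply: be.
exists Q, (`|q b| + 1 + M / e); split => //.
- move=> z Az; have [->|zb] := eqVneq z b.
    exact: (holomorphic_at_near _ _ _ Qq).
  apply: holomorphic_at_near (Qnear _ zb) _.
  by apply: holomorphic_atM; [exact: holf|exact: hinv].
- move=> z Az; have M0 : 0 <= M := le_trans (normr_ge0 _) (fM z Az).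
  have [bz|bz] := boolP (`|b - z| < e).
    by rewrite (le_trans (Qe z bz))// lerDl divr_ge0// ltW.
  rewrite -real_leNgt ?num_real ?normr_real ?gtr0_real// in bz.
  have zb : z != b.
    apply/eqP => zb; rewrite zb subrr normr0 in bz.
    by rewrite (lt_geF e0) in bz.
  rewrite ler_wpDl ?addr_ge0// /Q ifN// normrM normfV ler_pM ?invr_ge0 ?fM//.
  by rewrite lef_pV2 ?posrE ?normr_gt0 ?subr_eq0// distrC.
move=> c cb fc; apply: removable_zero_near (Qnear _ cb) _.
by apply: removable_zeroM => //; exact: hinv.
Unshelve. all: by end_near. Qed.

(** * Automorphisms of the disc *)

Lemma unit_disc_near {R : realType} (c : R[i]) : unit_disc c ->
  \forall z \near (c : (R[i] : numFieldType)), unit_disc z.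
Proof.
rewrite /unit_disc/= => c1.
have e0 : 0 < 1 - `|c| by rewrite subr_gt0.
have h := near_dist_lt _ _ e0.
near=> z.
have : `|c - z| < 1 - `|c| by near: z; exact: h.
rewrite distrC ltrBrDr; apply: le_lt_trans.
by rewrite -{1}[z](subrK c) ler_normD.
Unshelve. all: by end_near. Qed.

(** The denominators of disc automorphisms stay in the right half-plane, where
    the logarithm is available. *)
Lemma Re_denom_gt0 {R : realType} (a z : R[i]) :
  `|a| * `|z| < 1 -> 0 < complex.Re (1 - a^* * z).
Proof.
move=> az1; rewrite ReB /= subr_gt0.
rewrite (le_lt_trans (ler_norm _))// (le_lt_trans (Re_le_cmod _))//.
by rewrite -ltcR -normc_cmod normrM norm_conjC.
Qed.

Lemma norm_mul_lt1 {R : realType} (a z : R[i]) :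
  unit_disc a -> closed_unit_disc z -> `|a| * `|z| < 1.
Proof.
move=> a1 z1; rewrite (le_lt_trans _ (a1 : `|a| < 1))//.
by rewrite ler_piMr.
Qed.

Lemma denom_neq0 {R : realType} (a z : R[i]) :
  `|a| * `|z| < 1 -> 1 - a^* * z != 0.
Proof.
move=> /Re_denom_gt0 h; apply/eqP => h0; by rewrite h0 ltxx in h.
Qed.

Lemma denom_holomorphic {R : realType} (a z : R[i]) :
  holomorphic_at (fun z => 1 - a^* * z) z.
Proof.
apply: holomorphic_atB; first exact: holomorphic_at_cst.
by apply: holomorphic_atM; [exact: holomorphic_at_cst|exact: holomorphic_at_id].
Qed.

Lemma unit_circle_mulJ {R : realType} (w : R[i]) : unit_circle w -> w * w^* = 1.
Proof. by rewrite /unit_circle/= -normCK => ->; rewrite expr1n. Qed.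

(** Increments of Moebius maps factor exactly, which yields their derivative and
    the divisibility of the increment at once. *)
Lemma disc_aut_sub {R : realType} (lam a z c : R[i]) :
  1 - a^* * z != 0 -> 1 - a^* * c != 0 ->
  disc_aut lam a z - disc_aut lam a c =
  (z - c) * (lam * (1 - a * a^*) / (1 - a^* * c) / (1 - a^* * z)).
Proof. by move=> z0 c0; rewrite /disc_aut; field; rewrite z0 c0. Qed.

Lemma denom_inv_holomorphic {R : realType} (a c k : R[i]) :
  `|a| * `|c| < 1 -> holomorphic_at (fun z => k / (1 - a^* * z)) c.
Proof.
move=> ac; apply: holomorphic_atM; first exact: holomorphic_at_cst.
by apply: holomorphic_atV; [exact: denom_neq0|exact: denom_holomorphic].
Qed.

Lemma disc_mul_lt1 {R : realType} (a z : R[i]) :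
  unit_disc a -> unit_disc z -> `|a| * `|z| < 1.
Proof. by move=> ha /ltW hz; exact: norm_mul_lt1. Qed.

Lemma disc_aut_disc {R : realType} (lam a z : R[i]) :
  unit_circle lam -> unit_disc a -> unit_disc z -> unit_disc (disc_aut lam a z).
Proof.
move=> hlam ha hz; have d0 : 1 - a^* * z != 0.
  by rewrite denom_neq0// disc_mul_lt1.
rewrite /unit_disc/= /disc_aut normrM normfV normrM (hlam : `|lam| = 1) mul1r.
rewrite ltr_pdivrMr ?normr_gt0// mul1r -(ltr_pXn2r (_ : (0 < 2)%N))// ?nnegrE//.
rewrite !normCK !rmorphB !rmorphM/= rmorph1 conjCK -subr_gt0.
rewrite (_ : _ - _ = (1 - a * a^*) * (1 - z * z^*)); last by ring.
by rewrite -!normCK mulr_gt0// subr_gt0 expr_lt1.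
Qed.

Lemma disc_aut_sub_near {R : realType} (lam a c : R[i]) :
  unit_disc a -> unit_disc c ->
  \forall z \near (c : (R[i] : numFieldType)),
    disc_aut lam a z - disc_aut lam a c =
    (z - c) * (lam * (1 - a * a^*) / (1 - a^* * c) / (1 - a^* * z)).
Proof.
move=> ha hc; have hD := unit_disc_near _ hc; near=> z; apply: disc_aut_sub.
  have : unit_disc z by near: z; exact: hD.
  by move=> hz; rewrite denom_neq0// disc_mul_lt1.
by rewrite denom_neq0// disc_mul_lt1.
Unshelve. all: by end_near. Qed.

Lemma disc_aut_removable_zero {R : realType} (lam a c : R[i]) :
  unit_disc a -> unit_disc c ->
  removable_zero (fun z => disc_aut lam a z - disc_aut lam a c) c.
Proof.
move=> ha hc.
exists (fun z => lam * (1 - a * a^*) / (1 - a^* * c) / (1 - a^* * z)).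
  exact/denom_inv_holomorphic/disc_mul_lt1.
exact: disc_aut_sub_near.
Qed.

Lemma disc_aut_holomorphic {R : realType} (lam a c : R[i]) :
  unit_disc a -> unit_disc c -> holomorphic_at (disc_aut lam a) c.
Proof.
move=> ha hc; apply: holomorphic_at_slope (disc_aut_sub_near lam _ _ ha hc).
exact/holomorphic_at_continuous/denom_inv_holomorphic/disc_mul_lt1.
Qed.

Lemma field_derive_disc_aut {R : realType} (lam a c : R[i]) :
  unit_disc a -> unit_disc c ->
  field_derive (disc_aut lam a) c = lam * (1 - a * a^*) / (1 - a^* * c) ^+ 2.
Proof.
move=> ha hc.
rewrite (field_derive_slope _ _ _ _ (disc_aut_sub_near lam _ _ ha hc)).
  by rewrite -mulrA -invfM.
exact/holomorphic_at_continuous/denom_inv_holomorphic/disc_mul_lt1.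
Qed.

Lemma disc_autK {R : realType} (lam a z : R[i]) :
  unit_circle lam -> unit_disc a -> unit_disc z ->
  disc_aut lam^* (- (lam * a)) (disc_aut lam a z) = z.
Proof.
move=> hlam ha hz; have d0 : 1 - a^* * z != 0.
  by rewrite denom_neq0// disc_mul_lt1.
have a0 : 1 - a * a^* != 0.
  by rewrite -normCK subr_eq0 eq_sym lt_eqF// expr_lt1.
have lamJ : lam^* * lam = 1 by rewrite mulrC unit_circle_mulJ.
rewrite {1}/disc_aut.
have -> : lam^* * (disc_aut lam a z - - (lam * a)) =
    lam^* * lam * (z * (1 - a * a^*) / (1 - a^* * z)).
  by rewrite /disc_aut; field.
have -> : 1 - (- (lam * a))^* * disc_aut lam a z =
    (1 - a^* * z + lam^* * lam * (a^* * (z - a))) / (1 - a^* * z).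
  by rewrite /disc_aut rmorphN rmorphM/=; field.
rewrite lamJ mul1r mul1r.
by field; rewrite d0 (_ : 1 - a^* * z + _ = 1 - a * a^*) //; ring.
Qed.

Lemma disc_autVK {R : realType} (lam a z : R[i]) :
  unit_circle lam -> unit_disc a -> unit_disc z ->
  disc_aut lam a (disc_aut lam^* (- (lam * a)) z) = z.
Proof.
move=> hlam ha hz.
have hlam' : unit_circle lam^* by rewrite /unit_circle/= norm_conjC.
have ha' : unit_disc (- (lam * a)).
  by rewrite /unit_disc/= normrN normrM (hlam : `|lam| = 1) mul1r.
have := disc_autK _ _ _ hlam' ha' hz.
by rewrite conjCK mulrN opprK mulrA [lam^* * lam]mulrC unit_circle_mulJ// mul1r.
Qed.

Lemma cexpN {R : realType} (z : R[i]) : cexp (- z) = (cexp z)^-1.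
Proof.
have h : cexp z * cexp (- z) = 1 by rewrite -cexpD subrr cexp0.
apply/esym/(mulfI (x := cexp z)).
  by apply/eqP => z0; move: h => /eqP; rewrite z0 mul0r eq_sym oner_eq0.
rewrite h divff//.
by apply/eqP => z0; move: h => /eqP; rewrite z0 mul0r eq_sym oner_eq0.
Qed.

Lemma cexp_ln {R : realType} (x : R) : 0 < x -> cexp (ln x)%:C%C = x%:C%C.
Proof.
move=> x0; rewrite /cexp /expi/= lnK ?posrE// cos0 sin0.
by apply/eqP; rewrite eq_complex /=; apply/andP; split; apply/eqP; ring.
Qed.

(** * The weight of the composition operator *)

(** A logarithm of lam^* phi'(z) = (1 - |a|^2) / (1 - a^* z)^2. As 1 - a^* z
    lies in the right half-plane, the argument of its square lies in
    ]-pi, pi[, so this is the principal logarithm. *)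
Definition log_jacobian {R : realType} (a z : R[i]) : R[i] :=
  (ln (1 - cmod a ^+ 2))%:C%C - 2 * clog (1 - a^* * z).

Lemma log_jacobian_holomorphic {R : realType} (a c : R[i]) :
  `|a| * `|c| < 1 -> holomorphic_at (log_jacobian a) c.
Proof.
move=> ac; apply: holomorphic_atB; first exact: holomorphic_at_cst.
apply: holomorphic_atM; first exact: holomorphic_at_cst.
apply: (holomorphic_at_comp (fun z => 1 - a^* * z)).
  exact: denom_holomorphic.
exact/clog_holomorphic/Re_denom_gt0.
Qed.

Lemma one_sub_sqr_gt0 {R : realType} (a : R[i]) :
  unit_disc a -> 0 < 1 - cmod a ^+ 2.
Proof.
move=> a1; rewrite subr_gt0 expr_lt1 ?cmod_ge0//.
by rewrite -ltcR -normc_cmod.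
Qed.

Lemma cexp_log_jacobian {R : realType} (lam a z : R[i]) :
  unit_circle lam -> unit_disc a -> unit_disc z ->
  lam^* * field_derive (disc_aut lam a) z = cexp (log_jacobian a z).
Proof.
move=> hlam ha hz.
have az : `|a| * `|z| < 1 by rewrite disc_mul_lt1.
rewrite field_derive_disc_aut// !mulrA [lam^* * lam]mulrC.
rewrite (unit_circle_mulJ _ hlam) mul1r.
rewrite /log_jacobian cexpD cexp_ln ?one_sub_sqr_gt0//.
rewrite cexpN mulr_natl mulr2n cexpD clogK ?Re_denom_gt0//.
congr (_ / _); first by rewrite -normCK normc_cmod rmorphB rmorphXn.
Qed.

Lemma Im_log_jacobian {R : realType} (a z : R[i]) :
  - pi < complex.Im (log_jacobian a z) < pi.
Proof.
rewrite /log_jacobian ImB/=.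
set t := atan _.
have t1 := atan_gtNpi2 (complex.Im (1 - a^* * z) / complex.Re (1 - a^* * z)).
have t2 := atan_ltpi2 (complex.Im (1 - a^* * z) / complex.Re (1 - a^* * z)).
rewrite -/t in t1 t2.
lra.
Qed.

Lemma principal_root_jacobian {R : realType} (p : R) (lam a z : R[i]) :
  unit_circle lam -> unit_disc a -> unit_disc z ->
  principal_root p (lam^* * field_derive (disc_aut lam a) z) =
  cexp (p^-1%:C%C * log_jacobian a z).
Proof.
move=> hlam ha hz.
by rewrite cexp_log_jacobian// principal_root_cexp// Im_log_jacobian.
Qed.

(** Written as an exponential, so that it needs no discussion of zeros. *)
Definition inverse_weight {R : realType} (p : R) (a z : R[i]) : R[i] :=
  cexp (- (p^-1%:C%C * log_jacobian a z)).

Lemma inverse_weightE {R : realType} (p : R) (lam a z : R[i]) :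
  unit_circle lam -> unit_disc a -> unit_disc z ->
  principal_root p (lam^* * field_derive (disc_aut lam a) z) *
  inverse_weight p a z = 1.
Proof.
by move=> hlam ha hz; rewrite principal_root_jacobian// -cexpD subrr cexp0.
Qed.

Lemma inverse_weight_holomorphic {R : realType} (p : R) (a c : R[i]) :
  `|a| * `|c| < 1 -> holomorphic_at (inverse_weight p a) c.
Proof.
move=> ac.
apply: (holomorphic_at_comp _ (@cexp R)); last exact: cexp_holomorphic.
under [X in holomorphic_at X _]eq_fun do rewrite -mulNr.
apply: holomorphic_atM; first exact: holomorphic_at_cst.
exact: log_jacobian_holomorphic.
Qed.

Lemma inverse_weight_bounded {R : realType} (p : R) (a : R[i]) :
  0 < p -> unit_disc a ->
  exists M : R[i], forall z, unit_disc z -> `|inverse_weight p a z| <= M.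
Proof.
move=> p0 ha.
exists (expR (p^-1 * (2 * ln 2 - ln (1 - cmod a ^+ 2))))%:C%C => z hz.
have az : `|a| * `|z| < 1 by rewrite disc_mul_lt1.
have d0 := cmod_gt0 _ (Re_denom_gt0 _ _ az).
rewrite normc_cmod lecR cmod_cexp ler_expR /log_jacobian.
rewrite /= !mul0r !subr0.
rewrite -mulrN ler_pM2l ?invr_gt0//.
have : ln (cmod (1 - a^* * z)) <= ln 2.
  rewrite ler_ln ?posrE// -lecR -normc_cmod rmorph_nat.
  rewrite (le_trans (ler_normB _ _))// normr1 normrM norm_conjC.
  by rewrite -[2]/(1 + 1) lerD2l ltW.
lra.
Qed.

(** * Parabolic automorphisms are translations *)

(** Maps the disc into the right half-plane and sends w to infinity. *)
Definition cayley {R : realType} (w z : R[i]) : R[i] := (1 - w^* * z)^-1.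

(** The fixed points are the roots of a^* z^2 + (lam - 1) z - lam a, whose
    product -(lam a) / a^* has modulus 1. The root other than w would therefore
    be another fixed point on the circle; hence w is a double root and the
    coefficients are given by Vieta's formulas. *)
Lemma parabolic_fixed_point {R : realType} (lam a : R[i]) :
  unit_circle lam -> unit_disc a -> parabolic (disc_aut lam a) ->
  exists2 w, unit_circle w &
    [/\ a != 0, lam * a = - (w ^+ 2 * a^*) & lam = 1 - 2 * (w * a^*)].
Proof.
move=> hlam ha [_ _ [w hw fixw]].
have wn0 : w != 0.
  by rewrite -normr_gt0 (hw : `|w| = 1).
have a0 : a != 0.
  apply/eqP => a0; have : closed_unit_disc (0 : R[i]).
    by rewrite /closed_unit_disc/= normr0.
  move=> /fixw[+ _]; rewrite /disc_aut a0 subrr mulr0 mul0r => /(_ erefl) w0.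
  by rewrite -w0 eqxx in wn0.
have aJ0 : a^* != 0 by rewrite conjC_eq0.
have fixE z : closed_unit_disc z ->
    (disc_aut lam a z = z <-> a^* * z ^+ 2 + (lam - 1) * z - lam * a = 0).
  move=> hz; have d0 : 1 - a^* * z != 0 by rewrite denom_neq0// norm_mul_lt1.
  rewrite /disc_aut; split => [/(canRL (divfK d0)) E|E].
    rewrite mulrBr in E.
    rewrite [X in X = 0](_ : _ = lam * z - lam * a - z * (1 - a^* * z)).
      by rewrite E subrr.
    ring.
  apply: (canLR (mulfK d0)); apply/eqP; rewrite -subr_eq0; apply/eqP.
  by rewrite -[RHS]E; ring.
have hwc : closed_unit_disc w by rewrite /closed_unit_disc/= (hw : `|w| = 1).
have Ew := (fixE w hwc).1 ((fixw w hwc).2 erefl).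
(* The second root, read off from the product of the roots. *)
pose w' := - (lam * a) / (a^* * w).
have hw'c : closed_unit_disc w'.
  rewrite /closed_unit_disc/= /w' normrM normfV normrN !normrM norm_conjC.
  by rewrite (hlam : `|lam| = 1) (hw : `|w| = 1) mul1r mulr1 divff ?normr_eq0.
have lamE : lam - 1 = - (a^* * (w' + w)).
  apply: (mulIf wn0); apply/eqP; rewrite -subr_eq0; apply/eqP.
  by rewrite -[RHS]Ew /w'; field; rewrite wn0 aJ0.
have Ew' : a^* * w' ^+ 2 + (lam - 1) * w' - lam * a = 0.
  by rewrite lamE /w'; field; rewrite wn0 aJ0.
have w'w : w' = w by apply/(fixw w' hw'c).1/(fixE w' hw'c).2.
exists w => //; split => //.
  rewrite expr2 -{1}w'w /w'; field; rewrite wn0 aJ0 //.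
rewrite -[LHS](subrK 1) lamE w'w; ring.
Qed.

(** The translation length is kap = v / (1 - v) with v = a^* w = (1 - lam) / 2.
    As |lam| = 1, v + v^* = 2 |v|^2, which says that kap is purely imaginary. *)
Lemma parabolic_translation {R : realType} (lam a : R[i]) :
  unit_circle lam -> unit_disc a -> parabolic (disc_aut lam a) ->
  exists w (k : R), [/\ unit_circle w, k != 0 & forall z, unit_disc z ->
    cayley w (disc_aut lam a z) = cayley w z + Complex 0 k].
Proof.
move=> hlam ha hp.
have [w hw [a0 E1 E2]] := parabolic_fixed_point _ _ hlam ha hp.
have wJ := unit_circle_mulJ _ hw.
have lJ := unit_circle_mulJ _ hlam.
have aw : `|a| * `|w| < 1 by rewrite (hw : `|w| = 1) mulr1.
have c0 : 1 - a^* * w != 0 by rewrite denom_neq0.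
pose kap := (a^* * w) / (1 - a^* * w).
have kap0 : kap != 0.
  rewrite mulf_neq0 ?invr_eq0// mulf_neq0 ?conjC_eq0//.
  by rewrite -normr_gt0 (hw : `|w| = 1).
have kapJ : kap + kap^* = 0.
  have c0' : 1 - a * w^* != 0.
    by rewrite -[a]conjCK -rmorphM -(rmorph1 Num.conj) -rmorphB conjC_eq0.
  have h : a^* * w + a * w^* = 2 * (a^* * w) * (a * w^*).
    have : (1 - 2 * (a^* * w)) * (1 - 2 * (a * w^*)) = 1.
      by rewrite -[RHS]lJ E2 rmorphB rmorph1 !rmorphM/= rmorph_nat conjCK; ring.
    move=> h; have : 2 * (a^* * w + a * w^*) = 2 * (2 * (a^* * w) * (a * w^*)).
      transitivity (4 * (a^* * w) * (a * w^*) + 1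
        - (1 - 2 * (a^* * w)) * (1 - 2 * (a * w^*))); first by ring.
      rewrite h; ring.
    by apply: mulfI; rewrite pnatr_eq0.
  rewrite /kap rmorphM/= fmorphV/= rmorphB rmorph1 !rmorphM/= conjCK.
  have -> : a^* * w / (1 - a^* * w) + a * w^* / (1 - a * w^*) =
    (a^* * w + a * w^* - 2 * (a^* * w) * (a * w^*)) /
    ((1 - a^* * w) * (1 - a * w^*)).
    by field; rewrite c0 c0'.
  by rewrite h subrr mul0r.
have Rek : complex.Re kap = 0.
  have := congr1 (@complex.Re R) kapJ; case: (kap) => x y/=; lra.
exists w, (complex.Im kap); split => //.
  by apply: contra_neq kap0; case: kap Rek {kapJ} => x y /= -> ->.
move=> z hz.
have -> : Complex 0 (complex.Im kap) = kap.
  by case: kap Rek {kap0 kapJ} => x y /= ->.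
have d0 : 1 - a^* * z != 0 by rewrite denom_neq0// disc_mul_lt1.
have e0 : 1 - w^* * z != 0 by rewrite denom_neq0// (hw : `|w| = 1) mul1r.
have -> : cayley w (disc_aut lam a z) =
   (1 - a^* * z) / ((1 - a^* * w) * (1 - w^* * z)).
  rewrite /cayley; apply: (canLR (@invrK _)); rewrite invf_div.
  apply: (mulIf d0); rewrite divfK// mulrBl mul1r mulrA.
  rewrite /disc_aut mulrA divfK//.
  have -> : w^* * lam * (z - a) = w^* * lam * z - w^* * (lam * a) by ring.
  rewrite E1 {1}E2.
  have -> : w^* * (1 - 2 * (w * a^*)) * z - w^* * - (w ^+ 2 * a^*)
     = w^* * z - 2 * (w * w^*) * a^* * z + w * w^* * (w * a^*) by ring.
  have -> : (1 - a^* * w) * (1 - w^* * z)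
    = 1 - a^* * w - w^* * z + (w * w^*) * (a^* * z) by ring.
  rewrite wJ; ring.
have -> : 1 - a^* * z = 1 - w * w^* * (a^* * z) by rewrite wJ mul1r.
by rewrite /cayley /kap; field; rewrite c0 e0.
Qed.

(** * Solving S h = f for functions divisible along a backward orbit *)

(** Vanishing off the disc is the convention by which elements of the Hardy
    space are encoded. Divisibility is demanded once at each point of Z: all
    zeros that have to be divided out are simple and distinct. *)
Definition divisible_along {R : realType} (Z : set R[i]) (f : R[i] -> R[i]) :=
  [/\ forall z, ~ unit_disc z -> f z = 0, holomorphic_on (@unit_disc R) f,
      exists M, forall z, unit_disc z -> `|f z| <= M &
      forall c, Z c -> removable_zero f c].

Lemma divisible_along_hardy {R : realType} (p : R) (Z : set R[i])
    (f : R[i] -> R[i]) :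
  0 < p -> divisible_along Z f -> hardy p f.
Proof. by move=> p0 [f0 fh [M fM] _]; exact: bounded_holomorphic_hardy fM. Qed.

(** Since psi(z) = mu (z - b) / (1 - b^* z), dividing f by psi amounts to
    dividing out the zero at b and multiplying by the bounded factor
    (1 - b^* z) mu^*. The zero of the solution at c comes from that of f at
    phi^(-1)(c), which is not b, so that dividing by z - b leaves it intact. *)
Lemma divisible_along_preimage {R : realType} (p : R) (lam a mu b : R[i])
    (Z : set R[i]) (f : R[i] -> R[i]) :
  0 < p -> unit_circle lam -> unit_disc a -> unit_circle mu -> unit_disc b ->
  Z `<=` @unit_disc R -> Z b ->
  (forall c, Z c -> exists c', [/\ Z c', c' != b & disc_aut lam a c' = c]) ->
  divisible_along Z f ->
  exists2 h, divisible_along Z h &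
    mul_op (disc_aut mu b) (U_op p lam a h) = f.
Proof.
move=> p0 hlam ha hmu hb ZD Zb Zback [f0 fh [M fM] fZ].
have [Q [N [Qh QN fQ Qzero]]] := divide_zero _ _ _ _ fh fM (fZ b Zb).
have [N' kN'] := inverse_weight_bounded _ _ p0 ha.
(* 1 / (psi J) with the pole at b taken off *)
pose k y := (1 - b^* * y) * mu^* * inverse_weight p a y.
have kh c : unit_disc c -> holomorphic_at k c.
  move=> hc; apply: holomorphic_atM; last first.
    by apply/inverse_weight_holomorphic/disc_mul_lt1.
  apply: holomorphic_atM; last exact: holomorphic_at_cst.
  exact: denom_holomorphic.
(* the inverse automorphism phi^(-1) *)
pose V := disc_aut lam^* (- (lam * a)).
have hlam' : unit_circle lam^* by rewrite /unit_circle/= norm_conjC.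
have ha' : unit_disc (- (lam * a)).
  by rewrite /unit_disc/= normrN normrM (hlam : `|lam| = 1) mul1r.
have VD z : unit_disc z -> unit_disc (V z) by exact: disc_aut_disc.
have VE z : unit_disc z -> Q (V z) * k (V z) = comp_op V (fun y => Q y * k y) z.
  by rewrite /comp_op => hz; rewrite ifT.
have Vnear c : unit_disc c -> \forall z \near (c : (R[i] : numFieldType)),
    Q (V z) * k (V z) = comp_op V (fun y => Q y * k y) z.
  move=> hc; have hD := unit_disc_near _ hc.
  by near=> z; apply: VE; near: z; exact: hD.
exists (comp_op V (fun y => Q y * k y)).
  split.
  - by move=> z; rewrite /comp_op /unit_disc/= => /negP/negbTE ->.
  - move=> c hc; apply: holomorphic_at_near (Vnear c hc) _.
    apply: (holomorphic_at_comp V (fun y => Q y * k y)).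
      exact: disc_aut_holomorphic.
    by apply: holomorphic_atM; [exact: Qh (VD c hc)|exact: kh (VD c hc)].
  - exists (N * (2 * N')) => z hz.
    rewrite -VE// normrM ler_pM//; first exact/QN/VD.
    rewrite /k normrM ler_pM//; last exact/kN'/VD.
    rewrite normrM norm_conjC (hmu : `|mu| = 1) mulr1.
    rewrite (le_trans (ler_normB _ _))// normr1 normrM norm_conjC.
    rewrite -[2]/(1 + 1) lerD2l.
    exact/ltW/disc_mul_lt1/VD.
  - move=> c Zc; have hc := ZD c Zc; have [c' [Zc' c'b c'E]] := Zback c Zc.
    have Vc : V c = c' by rewrite -c'E /V disc_autK//; exact: ZD.
    apply: removable_zero_near (Vnear c hc) _.
    apply: (removable_zero_comp (fun y => Q y * k y) V).
    + rewrite Vc; apply: removable_zeroM; last exact/kh/ZD.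
      by apply: Qzero c'b _; exact: fZ.
    + exact: disc_aut_holomorphic.
    + exact: disc_aut_removable_zero.
apply/funext => z; rewrite /mul_op /U_op /mul_op.
have [hz|hz] := boolP (`|z| < 1); last first.
  by rewrite /comp_op (negbTE hz) !mulr0 f0//; exact/negP.
have hz' : unit_disc (disc_aut lam a z) by exact: disc_aut_disc.
rewrite /comp_op hz ifT// [V _]disc_autK//.
rewrite fQ /k /disc_aut -/(disc_aut lam a).
set J := principal_root _ _.
have d0 : 1 - b^* * z != 0 by apply/denom_neq0/disc_mul_lt1.
have JE : J * inverse_weight p a z = 1 by exact: inverse_weightE.
have muE := unit_circle_mulJ _ hmu.
transitivity ((mu * mu^*) * (J * inverse_weight p a z) * ((z - b) * Q z)).
  by field.
by rewrite muE JE !mul1r.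
Unshelve. all: by end_near. Qed.

Lemma divisible_along_iter {R : realType} (p : R) (lam a mu b : R[i])
    (Z : set R[i]) (f : R[i] -> R[i]) (n : nat) :
  0 < p -> unit_circle lam -> unit_disc a -> unit_circle mu -> unit_disc b ->
  Z `<=` @unit_disc R -> Z b ->
  (forall c, Z c -> exists c', [/\ Z c', c' != b & disc_aut lam a c' = c]) ->
  divisible_along Z f ->
  exists2 h, divisible_along Z h &
    iter n (fun f => mul_op (disc_aut mu b) (U_op p lam a f)) h = f.
Proof.
move=> p0 hlam ha hmu hb ZD Zb Zback.
elim: n f => [|n IHn] f fZ; first by exists f.
have [h hZ hE] := divisible_along_preimage _ _ _ _ _ _ _
  p0 hlam ha hmu hb ZD Zb Zback fZ.
have [h' h'Z h'E] := IHn h hZ.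
by exists h' => //; rewrite iterS h'E.
Qed.

(** * A bounded function that phi leaves invariant *)

Lemma Re_realM {R : realType} (x : R) (z : R[i]) :
  complex.Re (x%:C%C * z) = x * complex.Re z.
Proof. by case: z => u v /=; rewrite mul0r subr0. Qed.

Lemma Re_cayley_gt0 {R : realType} (w z : R[i]) :
  `|w| * `|z| < 1 -> 0 < complex.Re (cayley w z).
Proof.
move=> wz; have := Re_denom_gt0 _ _ wz; have := denom_neq0 _ _ wz.
rewrite /cayley; case: (1 - _) => x y /= xy x0.
by rewrite divr_gt0// ltr_pwDl// ?exprn_gt0// sqr_ge0.
Qed.

Lemma cayley_sub {R : realType} (w c z : R[i]) :
  1 - w^* * c != 0 -> 1 - w^* * z != 0 ->
  cayley w c - cayley w z = (z - c) * (- (w^* / (1 - w^* * c)) / (1 - w^* * z)).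
Proof. by move=> c0 z0; rewrite /cayley; field; rewrite c0 z0. Qed.

Lemma cexp_natmul {R : realType} (x : R[i]) (n : nat) :
  cexp x = 1 -> cexp (n%:R * x) = 1.
Proof.
move=> x1; elim: n => [|n IHn]; first by rewrite mul0r cexp0.
by rewrite -natr1 mulrDl mul1r cexpD IHn x1 mulr1.
Qed.

(** Invariant under the automorphism that translates cayley w by 2 pi i / om. *)
Definition orbit_function {R : realType} (om : R) (w b z : R[i]) : R[i] :=
  if `|z| < 1 then 1 - cexp (om%:C%C * (cayley w b - cayley w z)) else 0.

(** Boundedness comes from Re (cayley w z) > 0. At a zero c, periodicity lets
    the base point b be replaced by c, and then 1 - exp is the increment
    cayley w c - cayley w z, divisible by z - c, times the slope of exp. *)
Lemma orbit_function_divisible {R : realType} (om : R) (w b : R[i])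
    (Z : set R[i]) :
  0 < om -> unit_circle w -> Z `<=` @unit_disc R ->
  (forall c, Z c -> cexp (om%:C%C * (cayley w b - cayley w c)) = 1) ->
  divisible_along Z (orbit_function om w b).
Proof.
move=> om0 hw ZD Z1.
have wz z : unit_disc z -> `|w| * `|z| < 1 by rewrite (hw : `|w| = 1) mul1r.
pose G z := 1 - cexp (om%:C%C * (cayley w b - cayley w z)).
have GE c : unit_disc c -> \forall z \near (c : (R[i] : numFieldType)),
    G z = orbit_function om w b z.
  move=> hc; have hD := unit_disc_near _ hc.
  near=> z; rewrite /orbit_function ifT//; near: z; exact: hD.
have cay_h c : unit_disc c -> holomorphic_at (fun z => cayley w z) c.
  move=> hc; apply: holomorphic_atV; first exact/denom_neq0/wz.
  exact: denom_holomorphic.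
have arg_h c d : unit_disc c ->
    holomorphic_at (fun z => om%:C%C * (d - cayley w z)) c.
  move=> hc; apply: holomorphic_atM; first exact: holomorphic_at_cst.
  by apply: holomorphic_atB; [exact: holomorphic_at_cst|exact: cay_h].
split.
- by move=> z /negP/negbTE h; rewrite /orbit_function h.
- move=> c hc; apply: holomorphic_at_near (GE c hc) _.
  apply: holomorphic_atB; first exact: holomorphic_at_cst.
  apply: (holomorphic_at_comp _ (@cexp R)); last exact: cexp_holomorphic.
  exact: arg_h.
- exists (1 + (expR (om * complex.Re (cayley w b)))%:C%C) => z hz.
  rewrite /orbit_function ifT// (le_trans (ler_normB _ _))// normr1 lerD2l.
  rewrite normc_cmod lecR cmod_cexp ler_expR Re_realM.
  rewrite ReB ler_pM2l// gerBl ltW// Re_cayley_gt0//; exact: wz.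
- move=> c Zc; have hc := ZD c Zc.
  apply: removable_zero_near (GE c hc) _.
  exists (fun z => (om%:C%C * (w^* / (1 - w^* * c))) / (1 - w^* * z) *
      cexp_slope (om%:C%C * (cayley w c - cayley w z))).
    apply: holomorphic_atM; first exact/denom_inv_holomorphic/wz.
    apply: (holomorphic_at_comp _ (@cexp_slope R)); first exact: arg_h.
    by rewrite subrr mulr0; exact: cexp_slope_holomorphic0.
  have hD := unit_disc_near _ hc.
  near=> z; have hz : unit_disc z by near: z; exact: hD.
  have -> : G z = - (cexp (om%:C%C * (cayley w c - cayley w z)) - 1).
    rewrite /G opprB; congr (_ - _).
    rewrite -[RHS]mul1r -(Z1 c Zc) -cexpD; congr cexp; ring.
  rewrite cexp_slopeE cayley_sub; [ring|exact/denom_neq0/wz..].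
Unshelve. all: by end_near. Qed.

(** If it vanished, comparing the points 0 and w / 2, where cayley w takes the
    values 1 and 2, would give exp om = 1. *)
Lemma orbit_function_neq0 {R : realType} (om : R) (w b : R[i]) :
  0 < om -> unit_circle w -> orbit_function om w b <> cst 0.
Proof.
move=> om0 hw g0.
have wJ := unit_circle_mulJ _ hw.
have E z : unit_disc z -> cexp (om%:C%C * (cayley w b - cayley w z)) = 1.
  move=> hz; have := congr1 (fun f => f z) g0.
  by rewrite /orbit_function ifT// => /eqP; rewrite subr_eq0 eq_sym => /eqP.
have c0 : cayley w 0 = 1 by rewrite /cayley mulr0 subr0 invr1.
have c1 : cayley w (w / 2) = 2.
  by rewrite /cayley mulrA [w^* * w]mulrC wJ; field.
have E0 := E 0; rewrite c0 in E0.
have E1 := E (w / 2); rewrite c1 in E1.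
have : cexp (om%:C%C : R[i]) = 1.
  have -> : (om%:C%C : R[i]) =
    om%:C%C * (cayley w b - 1) - om%:C%C * (cayley w b - 2) by ring.
  rewrite cexpD cexpN E0 ?E1 ?invr1 ?mulr1//.
    rewrite /unit_disc/= normrM (hw : `|w| = 1) mul1r normfV.
    by rewrite invf_lt1 ?normr_gt0 ?ger0_norm ?ltr1n.
  by rewrite /unit_disc/= normr0.
move=> /(congr1 (@cmod R)); rewrite cmod_cexp /= /cmod normr1/= -expR0.
by move=> /expR_inj om00; rewrite om00 ltxx in om0.
Qed.

Lemma cexp_period {R : realType} (k : R) : k != 0 ->
  cexp ((2 * pi / `|k|)%:C%C * Complex 0 k) = 1.
Proof.
move=> k0; have [hk|hk] := leP 0 k.
  rewrite ger0_norm// /cexp /expi /= !mul0r mulr0 subr0 addr0 divfK//.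
  rewrite mulr_natl cos2pi sin2pi expR0; apply/eqP.
  by rewrite eq_complex/= !mulr0 !mul0r mulr1 subr0 addr0 !eqxx.
rewrite ltr0_norm// /cexp /expi /= !mul0r mulr0 subr0 addr0.
rewrite invrN mulrN mulNr divfK// cosN sinN.
rewrite mulr_natl cos2pi sin2pi expR0; apply/eqP.
by rewrite eq_complex/= oppr0 !mulr0 !mul0r mulr1 subr0 addr0 !eqxx.
Qed.

(** * The isometry is not Crownover *)

Theorem theorem4 (R : realType) (p : R) (hp1 : 1 <= p) (hp2 : p != 2)
  (lam a : R[i]) (hlam : unit_circle lam) (ha : unit_disc a)
  (hphi : parabolic (disc_aut lam a))
  (psi : R[i] -> R[i]) (hpsi : Aut_disc psi) :
  ~ crownover p (fun f => mul_op psi (U_op p lam a f)).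
Proof.
have p0 : 0 < p := lt_le_trans ltr01 hp1.
have [mu [b [hmu hb ->]]] := hpsi.
have [w [k [hw k0 transl]]] := parabolic_translation _ _ hlam ha hphi.
pose om := 2 * pi / `|k|.
have om0 : 0 < om by rewrite divr_gt0 ?mulr_gt0 ?pi_gt0 ?normr_gt0.
(* the backward orbit of b, in the translation coordinate *)
pose Z := [set c | unit_disc c /\
  exists n : nat, cayley w b = cayley w c + n%:R * Complex 0 k].
have ZD : Z `<=` @unit_disc R by move=> c [].
have Zb : Z b by split => //; exists 0%N; rewrite mul0r addr0.
have Zback c : Z c -> exists c', [/\ Z c', c' != b & disc_aut lam a c' = c].
  move=> [hc [n cE]]; exists (disc_aut lam^* (- (lam * a)) c).
  have c'E : disc_aut lam a (disc_aut lam^* (- (lam * a)) c) = c.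
    exact: disc_autVK.
  have hc' : unit_disc (disc_aut lam^* (- (lam * a)) c).
    apply: disc_aut_disc => //; first by rewrite /unit_circle/= norm_conjC.
    by rewrite /unit_disc/= normrN normrM (hlam : `|lam| = 1) mul1r.
  move: (disc_aut lam^* _ c) c'E hc' => c' c'E hc'.
  (* One step back increases the index, so the index of c' is positive; c' = b
     would force (n + 1) i k = 0. *)
  have bE : cayley w b = cayley w c' + n.+1%:R * Complex 0 k.
    by rewrite cE -c'E transl// -natr1; ring.
  split => //; first by split => //; exists n.+1.
  apply/eqP => c'b; move: bE; rewrite c'b => /eqP.
  rewrite eq_sym -subr_eq0 addrC addKr mulf_eq0 pnatr_eq0/= eq_complex/=.
  by rewrite (negbTE k0) andbF.
have Z1 c : Z c -> cexp (om%:C%C * (cayley w b - cayley w c)) = 1.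
  move=> [_ [n ->]]; rewrite addrC addKr mulrCA.
  exact/cexp_natmul/cexp_period.
have gZ := orbit_function_divisible om w b Z om0 hw ZD Z1.
move=> H; apply: (orbit_function_neq0 om w b om0 hw).
have : [set cst 0] (orbit_function om w b); last by [].
rewrite -H => n _.
have [h hZ hE] := divisible_along_iter _ _ _ _ _ _ _ n
  p0 hlam ha hmu hb ZD Zb Zback gZ.
by exists h; [exact: divisible_along_hardy hZ|].
Qed.
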